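(* Let $\mathfrak{g}=\mathfrak{sp}_4(\mathbb{C})$ (type $C_2$). Let $\lambda=c_1\varpi_1+c_2\varpi_2$ with $c_1,c_2\in\mathbb{Z}$ and $2\mid c_1$, and let $\mu=n\varpi_1+m\varpi_2$ with $n,m\in\mathbb{N}$ and $2\mid n$. Consider the inequalities $L_1:\ c_1+c_2-n-m\ge 0$; $L_2:\ \tfrac{c_1-n}{2}+c_2-m\ge 0$; $L_3:\ c_2-n-m-1\ge 0$; $L_4:\ \tfrac{c_1-n}{2}-m-1\ge 0$; $L_5:\ \tfrac{-c_1-n}{2}-m-2\ge 0$; $L_6:\ -c_2-n-m-3\ge 0$; $L_7:\ -c_1-c_2-n-m-4\ge 0$; $L_8:\ \tfrac{-c_1-n}{2}-c_2-m-3\ge 0$, and write $\neg L_i$ for the failure of $L_i$. Then $\mathcal{A}(\lambda,\mu)$ equals: $\{1\}$ if $L_1,L_2,\neg L_4,\neg L_3$; $\{s_1\}$ if $L_3,L_2,\neg L_5,\neg L_1$; $\{s_2\}$ if $L_1,L_4,\neg L_2,\neg L_6$; $\{s_2s_1\}$ if $L_3,L_5,\neg L_2,\neg L_7$; $\{s_1s_2\}$ if $L_6,L_4,\neg L_8,\neg L_1$; $\{s_1s_2s_1\}$ if $L_7,L_5,\neg L_8,\neg L_3$; $\{s_2s_1s_2\}$ if $L_6,L_8,\neg L_4,\neg L_7$; $\{(s_2s_1)^2\}$ if $L_7,L_8,\neg L_5,\neg L_6$; $\{1,s_1\}$ if $L_1,L_3,\neg L_4,\neg L_5$; $\{1,s_2\}$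 if $L_2,L_4,\neg L_3,\neg L_6$; $\{s_1,s_2s_1\}$ if $L_2,L_5,\neg L_1,\neg L_7$; $\{s_2,s_1s_2\}$ if $L_1,L_6,\neg L_2,\neg L_8$; $\{s_2s_1,s_1s_2s_1\}$ if $L_3,L_7,\neg L_2,\neg L_8$; $\{s_1s_2,s_2s_1s_2\}$ if $L_4,L_8,\neg L_1,\neg L_7$; $\{s_1s_2s_1,(s_2s_1)^2\}$ if $L_5,L_8,\neg L_6,\neg L_3$; $\{s_2s_1s_2,(s_2s_1)^2\}$ if $L_6,L_7,\neg L_5,\neg L_4$; $\{1,s_1,s_2s_1\}$ if $L_1,L_5,\neg L_4,\neg L_7$; $\{1,s_1,s_2\}$ if $L_3,L_4,\neg L_5,\neg L_6$; $\{1,s_2,s_1s_2\}$ if $L_2,L_6,\neg L_3,\neg L_8$; $\{s_2,s_1s_2,s_2s_1s_2\}$ if $L_1,L_8,\neg L_2,\neg L_7$; $\{s_1s_2,s_2s_1s_2,(s_2s_1)^2\}$ if $L_7,L_4,\neg L_5,\neg L_1$; $\{s_2s_1s_2,(s_2s_1)^2,s_1s_2s_1\}$ if $L_6,L_5,\neg L_4,\neg L_3$; $\{(s_2s_1)^2,s_1s_2s_1,s_2s_1\}$ if $L_3,L_8,\neg L_2,\neg L_6$; $\{s_1,s_2s_1,s_1s_2s_1\}$ if $L_7,L_2,\neg L_8,\neg L_1$; and $\emptyset$ otherwise.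
   Context: $\mathfrak{sp}_4(\mathbb{C})$ has simple roots $\alpha_1$ (short), $\alpha_2$ (long), positive roots $\Phi^+=\{\alpha_1,\alpha_2,\alpha_1+\alpha_2,2\alpha_1+\alpha_2\}$, fundamental weights $\varpi_1=\alpha_1+\tfrac12\alpha_2$, $\varpi_2=\alpha_1+\alpha_2$, and $\rho=\varpi_1+\varpi_2=2\alpha_1+\tfrac32\alpha_2$. The Weyl group $W$ (dihedral of order 8) is generated by the simple reflections $s_1,s_2$, acting linearly with $s_i(\alpha_i)=-\alpha_i$, $s_1(\alpha_2)=\alpha_2+2\alpha_1$, $s_2(\alpha_1)=\alpha_1+\alpha_2$, and $s_i(\varpi_j)=\varpi_j-\delta_{ij}\alpha_j$. $\mathbb{N}=\{0,1,2,\dots\}$. Kostant's partition function $\wp(\xi)$ is the number of ways to write $\xi$ as a nonnegative integral linear combination of positive roots. The Weyl alternation set is $\mathcal{A}(\lambda,\mu)=\{\sigma\in W:\ \wp(\sigma(\lambda+\rho)-(\mu+\rho))>0\}$. *)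

(* Defs.v *)
From mathcomp Require Import all_boot all_order all_algebra.
From mathcomp Require Import finmap.
From mathcomp Require Import boolp classical_sets functions cardinality.
From mathcomp Require Import ring.

Set Implicit Arguments.
Unset Strict Implicit.
Unset Printing Implicit Defensive.

Import Order.TTheory GRing.Theory Num.Theory.
Local Open Scope classical_set_scope.
Local Open Scope ring_scope.

(* The rational span of the roots of sp_4(C), in coordinates with respect to
   the simple roots; it contains the whole weight lattice. *)
Definition wspace := 'cV[rat]_2.

Definition alpha1 : wspace := delta_mx 0 0.
Definition alpha2 : wspace := delta_mx 1 0.

Definition pos_roots : 4.-tuple wspace :=
  [tuple alpha1; alpha2; alpha1 + alpha2; alpha1 *+ 2 + alpha2].

Definition varpi1 : wspace := alpha1 + 2^-1 *: alpha2.
Definition varpi2 : wspace := alpha1 + alpha2.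
Definition rho : wspace := varpi1 + varpi2.

(* A linear map is represented by its matrix, acting on columns by
   left multiplication, so that s * t is the composite "t, then s".  The two
   columns below are the images of alpha1 and alpha2. *)
Definition s1 : 'M[rat]_2 := row_mx (- alpha1) (alpha2 + alpha1 *+ 2).
Definition s2 : 'M[rat]_2 := row_mx (alpha1 + alpha2) (- alpha2).

(* Words in s1 and s2; since s1 and s2 are involutions (s1K, s2K below), the
   monoid they generate is the group they generate. *)
Definition weyl : set 'M[rat]_2 :=
  [set w | exists2 s : seq 'M[rat]_2,
     all (mem [:: s1; s2]) s & w = \prod_(x <- s) x].

Definition kostant_ways (xi : wspace) : set {ffun 'I_4 -> nat} :=
  [set k | \sum_(i < 4) tnth pos_roots i *+ k i = xi].

(* fset_set returns the empty set on infinite sets; this never happens here,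
   by finite_kostant_ways below. *)
Definition kostant (xi : wspace) : nat := #|` fset_set (kostant_ways xi)|.

Definition alternation_set (lambda mu : wspace) : set 'M[rat]_2 :=
  [set w | weyl w /\ (0 < kostant (w *m (lambda + rho) - (mu + rho))%R)%N].

Lemma s1E (v : wspace) :
  s1 *m v = (- v 0 0 + v 1 0 *+ 2) *: alpha1 + v 1 0 *: alpha2.
Proof.
apply/colP => i; rewrite !mxE big_ord_recl big_ord1 /s1.
rewrite [ord0](_ : _ = lshift 1 (0 : 'I_1)); last exact/val_inj.
rewrite [lift _ _](_ : _ = rshift 1 (0 : 'I_1)); last exact/val_inj.
rewrite (row_mxEl (- alpha1)) (row_mxEr (- alpha1)) !mxE.
have -> : lshift 1 (0 : 'I_1) = 0 :> 'I_2 by exact/val_inj.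
have -> : rshift 1 (0 : 'I_1) = 1 :> 'I_2 by exact/val_inj.
by case: i => -[|[|//]] ? /=; ring.
Qed.

Lemma s2E (v : wspace) :
  s2 *m v = v 0 0 *: alpha1 + (v 0 0 - v 1 0) *: alpha2.
Proof.
apply/colP => i; rewrite !mxE big_ord_recl big_ord1 /s2.
rewrite [ord0](_ : _ = lshift 1 (0 : 'I_1)); last exact/val_inj.
rewrite [lift _ _](_ : _ = rshift 1 (0 : 'I_1)); last exact/val_inj.
rewrite (row_mxEl (alpha1 + alpha2)) (row_mxEr (alpha1 + alpha2)) !mxE.
have -> : lshift 1 (0 : 'I_1) = 0 :> 'I_2 by exact/val_inj.
have -> : rshift 1 (0 : 'I_1) = 1 :> 'I_2 by exact/val_inj.
by case: i => -[|[|//]] ? /=; ring.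
Qed.

Lemma mulmx_col_inj (A B : 'M[rat]_2) :
  (forall v : wspace, A *m v = B *m v) -> A = B.
Proof.
by move=> AB; apply/matrixP => i j; have /colP/(_ i) := AB (delta_mx j 0);
  rewrite -!colE !mxE.
Qed.

Lemma s1K : s1 * s1 = 1.
Proof.
apply: mulmx_col_inj => v; rewrite -mulmxA !s1E mul1mx.
apply/colP => -[[|[|//]] i1]; rewrite !mxE !eqE /=.
  by rewrite (_ : Ordinal i1 = 0); [ring | exact/val_inj].
by rewrite (_ : Ordinal i1 = 1); [ring | exact/val_inj].
Qed.

Lemma s2K : s2 * s2 = 1.
Proof.
apply: mulmx_col_inj => v; rewrite -mulmxA !s2E mul1mx.
apply/colP => -[[|[|//]] i1]; rewrite !mxE !eqE /=.
  by rewrite (_ : Ordinal i1 = 0); [ring | exact/val_inj].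
by rewrite (_ : Ordinal i1 = 1); [ring | exact/val_inj].
Qed.

Lemma s1_simple_roots :
  s1 *m alpha1 = - alpha1 /\ s1 *m alpha2 = alpha2 + alpha1 *+ 2.
Proof.
by split; rewrite s1E; apply/colP => -[[|[|//]] i1]; rewrite !mxE !eqE /=; ring.
Qed.

Lemma s2_simple_roots :
  s2 *m alpha1 = alpha1 + alpha2 /\ s2 *m alpha2 = - alpha2.
Proof.
by split; rewrite s2E; apply/colP => -[[|[|//]] i1]; rewrite !mxE !eqE /=; ring.
Qed.

Lemma s1_varpi : s1 *m varpi1 = varpi1 - alpha1 /\ s1 *m varpi2 = varpi2.
Proof.
by split; rewrite s1E; apply/colP => -[[|[|//]] i1]; rewrite !mxE !eqE /=; field.
Qed.

Lemma s2_varpi : s2 *m varpi1 = varpi1 /\ s2 *m varpi2 = varpi2 - alpha2.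
Proof.
by split; rewrite s2E; apply/colP => -[[|[|//]] i1]; rewrite !mxE !eqE /=; field.
Qed.

Lemma finite_kostant_ways (xi : wspace) : finite_set (kostant_ways xi).
Proof.
pose N := Num.bound (xi 0 0 + xi 1 0).
pose f (k : {ffun 'I_4 -> 'I_N.+1}) : {ffun 'I_4 -> nat} :=
  [ffun i => nat_of_ord (k i)].
suff sub : kostant_ways xi `<=` f @` setT.
  by apply: (sub_finite_set sub); apply: finite_image; exact: finite_finset.
move=> k kxi; have le_k i : ((k i)%:R <= xi 0 0 + xi 1 0 :> rat).
  rewrite -kxi !summxE -big_split /= (bigD1 i) //= -[leLHS]addr0.
  have ht j : (1 <= tnth pos_roots j 0 0 + tnth pos_roots j 1 0 :> rat).
    by case: j => -[|[|[|[|//]]]] jlt; rewrite /tnth /= !mxE !eqE /=.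
  apply: lerD; first by rewrite !mulmxnE -mulrnDl lerMn2r ht orbT.
  by apply: sumr_ge0 => j _; rewrite !mulmxnE -mulrnDl mulrn_wge0 // (le_trans _ (ht j)).
have lt_k i : (k i < N.+1)%N.
  rewrite ltnS -(ler_nat rat) (le_trans (le_k i)) // ltW // /N.
  by apply: archi_boundP; rewrite (le_trans _ (le_k i)).
exists [ffun i => Ordinal (lt_k i)] => //.
by apply/ffunP => i; rewrite !ffunE.
Qed.

(* Main.v *)
(* In the basis (alpha1, alpha2) Kostant's partition function is positive exactly
   on pairs of nonnegative integers.  The parity conditions make both coordinates
   of w (lambda + rho) - (mu + rho) integers for each of the eight w in W, and
   these coordinates are the left-hand sides of two of L_1, ..., L_8.  In the
   cyclic order 1, 2, 3, 5, 7, 8, 6, 4 each w corresponds to two neighbouring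
   inequalities, and those which hold form an arc of length at most four, so the
   alternation set is read off from the arc. *)
Require Import Defs.
From mathcomp Require Import all_boot all_order all_algebra.
From mathcomp Require Import finmap.
From mathcomp Require Import boolp classical_sets.
From mathcomp Require Import cardinality ring zify.

Import Order.TTheory GRing.Theory Num.Theory.
Local Open Scope classical_set_scope.
Local Open Scope ring_scope.

Lemma wspace_eq (u v : wspace) : u 0 0 = v 0 0 -> u 1 0 = v 1 0 -> u = v.
Proof.
move=> uv0 uv1; apply/colP => -[[|[|//]] i1].
  by rewrite (_ : Ordinal i1 = 0) //; exact/val_inj.
by rewrite (_ : Ordinal i1 = 1) //; exact/val_inj.
Qed.

Lemma kostant_gt0 (xi : wspace) :
  (0 < kostant xi)%N <-> exists k, kostant_ways xi k.
Proof.
rewrite /kostant cardfs_gt0; split.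
  case/fset0Pn => k; rewrite in_fset_set; last exact: finite_kostant_ways.
  by move=> /set_mem; exists k.
case=> k xik; apply/fset0Pn; exists k.
by rewrite in_fset_set; [apply/mem_set | exact: finite_kostant_ways].
Qed.

(** All positive roots have nonnegative coordinates; conversely the simple roots alone give a
    decomposition once [p] and [q] are nonnegative. *)
Lemma kostant_gt0_coords (xi : wspace) (p q : int) :
  xi 0 0 = p%:~R -> xi 1 0 = q%:~R ->
  (0 < kostant xi)%N = (0 <= p) && (0 <= q).
Proof.
move=> xi0 xi1; apply/idP/idP => [/kostant_gt0[k xik]|/andP[p0 q0]].
  rewrite -2!(ler0z rat) -xi0 -xi1 -xik !summxE.
  apply/andP; split; apply: sumr_ge0 => -[[|[|[|[|//]]]] ilt] _;
    by rewrite mulmxnE mulrn_wge0 // /tnth /= !mxE !eqE.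
(* The default of [nth] gives the two non-simple roots multiplicity 0. *)
apply/kostant_gt0; exists [ffun i : 'I_4 => nth 0%N [:: `|p|; `|q|]%N i].
rewrite /kostant_ways /= !big_ord_recl big_ord0 /tnth /= !ffunE /=.
apply: wspace_eq; rewrite ?xi0 ?xi1 !(mxE, mulmxnE) !eqE /= !mul0rn !mulr0n.
  by rewrite !addr0 -[in RHS](gez0_abs p0).
by rewrite !addr0 add0r -[in RHS](gez0_abs q0).
Qed.

(** A product of equations rather than a conjunction, so that it serves as one multirule for
    [rewrite]. *)
Lemma simple_reflection_coords (v : wspace) :
  ((s1 *m v) 0 0 = - v 0 0 + v 1 0 *+ 2) * ((s1 *m v) 1 0 = v 1 0) *
  ((s2 *m v) 0 0 = v 0 0) * ((s2 *m v) 1 0 = v 0 0 - v 1 0).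
Proof. by rewrite !(s1E, s2E); do !split; rewrite !mxE !eqE /=; ring. Qed.

Lemma s12_braid : s1 * s2 * s1 * s2 = s2 * s1 * s2 * s1.
Proof.
apply: mulmx_col_inj => v; rewrite -!mulmxA.
by apply: wspace_eq; rewrite !simple_reflection_coords; ring.
Qed.

Definition weyl_elements : seq 'M[rat]_2 :=
  [:: 1; s1; s2; s2 * s1; s1 * s2; s1 * s2 * s1; s2 * s1 * s2; (s2 * s1) ^+ 2].

(** The list contains 1 and is closed under left multiplication by [s1] and [s2]: the involution and
    braid relations reduce every such product to a listed word. *)
Lemma weylE : weyl = [set` weyl_elements].
Proof.
apply/seteqP; split=> w /=.
  case=> s + ->; elim: s => [|x s IHs] /=; first by rewrite big_nil !inE eqxx.
  case/andP=> xs /IHs; rewrite big_cons; move: (\prod_(y <- s) y) => u.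
  have s1K' y : s1 * (s1 * y) = y by rewrite mulrA s1K mul1r.
  have s2K' y : s2 * (s2 * y) = y by rewrite mulrA s2K mul1r.
  (* Gives the longest element a single spelling, in which a further [s1] on the left cancels. *)
  have braid : s2 * (s1 * (s2 * s1)) = s1 * (s2 * (s1 * s2)).
    by rewrite !mulrA s12_braid.
  rewrite /weyl_elements expr2 -!mulrA; move: xs; rewrite !inE.
  by case/orP=> /eqP->; do ?[case/orP]; move=> /eqP->;
    rewrite ?mulr1 ?s1K ?s2K ?s1K' ?s2K' ?braid ?s1K' ?s2K' ?eqxx ?orbT.
rewrite !inE; do ?[case/orP]; move=> /eqP->.
- by exists [::]; rewrite ?big_nil.
- by exists [:: s1]; rewrite /= ?inE ?eqxx ?orbT // !big_cons big_nil mulr1 ?expr2 ?mulrA.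
- by exists [:: s2]; rewrite /= ?inE ?eqxx ?orbT // !big_cons big_nil mulr1 ?expr2 ?mulrA.
- by exists [:: s2; s1]; rewrite /= ?inE ?eqxx ?orbT // !big_cons big_nil mulr1 ?expr2 ?mulrA.
- by exists [:: s1; s2]; rewrite /= ?inE ?eqxx ?orbT // !big_cons big_nil mulr1 ?expr2 ?mulrA.
- by exists [:: s1; s2; s1]; rewrite /= ?inE ?eqxx ?orbT // !big_cons big_nil mulr1 ?expr2 ?mulrA.
- by exists [:: s2; s1; s2]; rewrite /= ?inE ?eqxx ?orbT // !big_cons big_nil mulr1 ?expr2 ?mulrA.
- by exists [:: s2; s1; s2; s1]; rewrite /= ?inE ?eqxx ?orbT // !big_cons big_nil mulr1 ?expr2 ?mulrA.
Qed.

(** The halves [a] of $c_1$ and [b] of $n$ keep everything integral. The mask follows the order of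
    [weyl_elements]; each pair tests the [alpha1] coordinate, then the [alpha2] coordinate. *)
Lemma alternation_setE (a c b m : int) :
  let l1 := 0 <= a * 2 + c - b * 2 - m in
  let l2 := 0 <= a - b + c - m in
  let l3 := 0 <= c - b * 2 - m - 1 in
  let l4 := 0 <= a - b - m - 1 in
  let l5 := 0 <= - a - b - m - 2 in
  let l6 := 0 <= - c - b * 2 - m - 3 in
  let l7 := 0 <= - (a * 2) - c - b * 2 - m - 4 in
  let l8 := 0 <= - a - b - c - m - 3 in
  alternation_set (varpi1 *~ (a * 2) + varpi2 *~ c)
                  (varpi1 *~ (b * 2) + varpi2 *~ m) =
  [set` mask [:: l1 && l2; l3 && l2; l1 && l4; l3 && l5;
             l6 && l4; l7 && l5; l6 && l8; l7 && l8] weyl_elements].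
Proof.
move=> l1 l2 l3 l4 l5 l6 l7 l8.
set lam := varpi1 *~ (a * 2) + _; set mu := varpi1 *~ (b * 2) + _.
have lam0 : (lam + rho) 0 0 = a%:~R * 2 + c%:~R + 2.
  by rewrite /lam -!scaler_int !mxE !eqE /= intrM; field.
have lam1 : (lam + rho) 1 0 = a%:~R + c%:~R + 3 / 2.
  by rewrite /lam -!scaler_int !mxE !eqE /= intrM; field.
have mu0 : (mu + rho) 0 0 = b%:~R * 2 + m%:~R + 2.
  by rewrite /mu -!scaler_int !mxE !eqE /= intrM; field.
have mu1 : (mu + rho) 1 0 = b%:~R + m%:~R + 3 / 2.
  by rewrite /mu -!scaler_int !mxE !eqE /= intrM; field.
pose K w := (0 < kostant (w *m (lam + rho) - (mu + rho))%R)%N.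
have -> : [:: l1 && l2; l3 && l2; l1 && l4; l3 && l5;
             l6 && l4; l7 && l5; l6 && l8; l7 && l8] =
    map K weyl_elements.
  rewrite /= /K mul1mx -!mulmxE expr2 -mulmxE -!mulmxA.
  have subE (u v : wspace) i : (u - v) i 0 = u i 0 - v i 0 by rewrite !mxE.
  do 7?[congr (_ :: _)]; try congr [:: _]; apply/esym/kostant_gt0_coords;
    by rewrite subE ?simple_reflection_coords ?lam0 ?lam1 ?mu0 ?mu1;
       rewrite !(intrD, intrM, rmorphN) /=; field.
(* Masking a list by its values under [K] is filtering it by [K]. *)
rewrite -filter_mask /alternation_set weylE; move: weyl_elements => W.
apply/seteqP; split=> w /=; rewrite mem_filter; first by case=> -> Kw; rewrite andbT.
by case/andP.
Qed.

Lemma inequalities_arc (a c b m : int) : 0 <= b -> 0 <= m ->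
  let l1 := 0 <= a * 2 + c - b * 2 - m in
  let l2 := 0 <= a - b + c - m in
  let l3 := 0 <= c - b * 2 - m - 1 in
  let l4 := 0 <= a - b - m - 1 in
  let l5 := 0 <= - a - b - m - 2 in
  let l6 := 0 <= - c - b * 2 - m - 3 in
  let l7 := 0 <= - (a * 2) - c - b * 2 - m - 4 in
  let l8 := 0 <= - a - b - c - m - 3 in
  ([:: l1; l2; l3; l5; l7; l8; l6; l4] \in
    [seq rot k (nseq j true ++ nseq (8 - j) false) | k <- iota 0 8, j <- iota 0 5] : Prop).
Proof.
move=> b0 m0 l1 l2 l3 l4 l5 l6 l7 l8.
(* Opposite left-hand sides have a negative sum, $-4b-2m-4$ or $-2b-2m-3$. *)
have opposite : [&& ~~ (l1 && l7), ~~ (l2 && l8), ~~ (l3 && l6) &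
  ~~ (l5 && l4)].
  by rewrite /l1 /l2 /l3 /l4 /l5 /l6 /l7 /l8; do ?[apply/andP; split]; lia.
(* The sum of the two neighbours of a left-hand side $x$ is, alternately along the cycle, $2x-2b-1$
   or $x-m-1$. *)
have gap1 : [&& (l1 && l3 ==> l2), (l2 && l5 ==> l3), (l3 && l7 ==> l5),
  (l5 && l8 ==> l7), (l7 && l6 ==> l8),
  (l8 && l4 ==> l6), (l6 && l1 ==> l4) & (l4 && l2 ==> l1)].
  by rewrite /l1 /l2 /l3 /l4 /l5 /l6 /l7 /l8; do ?[apply/andP; split]; lia.
(* Combining two adjacent relations of this kind bounds both inner left-hand sides below by
   nonnegative combinations of the outer ones. *)
have gap2 : [&& (l1 && l5 ==> l2 && l3), (l2 && l7 ==> l3 && l5),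
  (l3 && l8 ==> l5 && l7), (l5 && l6 ==> l7 && l8),
  (l7 && l4 ==> l8 && l6), (l8 && l1 ==> l6 && l4),
  (l6 && l2 ==> l4 && l1) & (l4 && l3 ==> l1 && l2)].
  by rewrite /l1 /l2 /l3 /l4 /l5 /l6 /l7 /l8; do ?[apply/andP; split]; lia.
(* A subset of the 8-cycle that contains no antipodal pair and fills every gap of
   length one or two is an arc of length at most four. *)
move: l1 l2 l3 l4 l5 l6 l7 l8 opposite gap1 gap2.
by do 8!case.
Qed.

Theorem theorem3p4 (c1 c2 : int) (n m : nat)
    (hc1 : (2 %| c1)%Z) (hn : (2 %| n)%N) :
  let lambda := varpi1 *~ c1 + varpi2 *~ c2 in
  let mu := varpi1 *+ n + varpi2 *+ m in
  let C1 : rat := c1%:~R in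
  let C2 : rat := c2%:~R in
  let N : rat := n%:R in
  let M : rat := m%:R in
  let L1 := 0 <= C1 + C2 - N - M in
  let L2 := 0 <= (C1 - N) / 2 + C2 - M in
  let L3 := 0 <= C2 - N - M - 1 in
  let L4 := 0 <= (C1 - N) / 2 - M - 1 in
  let L5 := 0 <= (- C1 - N) / 2 - M - 2 in
  let L6 := 0 <= - C2 - N - M - 3 in
  let L7 := 0 <= - C1 - C2 - N - M - 4 in
  let L8 := 0 <= (- C1 - N) / 2 - C2 - M - 3 in
  let cases : seq (bool * set 'M[rat]_2) := [::
    ([&& L1, L2, ~~ L4 & ~~ L3], [set 1]);
    ([&& L3, L2, ~~ L5 & ~~ L1], [set s1]);
    ([&& L1, L4, ~~ L2 & ~~ L6], [set s2]);
    ([&& L3, L5, ~~ L2 & ~~ L7], [set s2 * s1]);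
    ([&& L6, L4, ~~ L8 & ~~ L1], [set s1 * s2]);
    ([&& L7, L5, ~~ L8 & ~~ L3], [set s1 * s2 * s1]);
    ([&& L6, L8, ~~ L4 & ~~ L7], [set s2 * s1 * s2]);
    ([&& L7, L8, ~~ L5 & ~~ L6], [set (s2 * s1) ^+ 2]);
    ([&& L1, L3, ~~ L4 & ~~ L5], [set 1; s1]);
    ([&& L2, L4, ~~ L3 & ~~ L6], [set 1; s2]);
    ([&& L2, L5, ~~ L1 & ~~ L7], [set s1; s2 * s1]);
    ([&& L1, L6, ~~ L2 & ~~ L8], [set s2; s1 * s2]);
    ([&& L3, L7, ~~ L2 & ~~ L8], [set s2 * s1; s1 * s2 * s1]);
    ([&& L4, L8, ~~ L1 & ~~ L7], [set s1 * s2; s2 * s1 * s2]);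
    ([&& L5, L8, ~~ L6 & ~~ L3], [set s1 * s2 * s1; (s2 * s1) ^+ 2]);
    ([&& L6, L7, ~~ L5 & ~~ L4], [set s2 * s1 * s2; (s2 * s1) ^+ 2]);
    ([&& L1, L5, ~~ L4 & ~~ L7], [set 1; s1; s2 * s1]);
    ([&& L3, L4, ~~ L5 & ~~ L6], [set 1; s1; s2]);
    ([&& L2, L6, ~~ L3 & ~~ L8], [set 1; s2; s1 * s2]);
    ([&& L1, L8, ~~ L2 & ~~ L7], [set s2; s1 * s2; s2 * s1 * s2]);
    ([&& L7, L4, ~~ L5 & ~~ L1],
       [set s1 * s2; s2 * s1 * s2; (s2 * s1) ^+ 2]);
    ([&& L6, L5, ~~ L4 & ~~ L3],
       [set s2 * s1 * s2; (s2 * s1) ^+ 2; s1 * s2 * s1]);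
    ([&& L3, L8, ~~ L2 & ~~ L6],
       [set (s2 * s1) ^+ 2; s1 * s2 * s1; s2 * s1]);
    ([&& L7, L2, ~~ L8 & ~~ L1], [set s1; s2 * s1; s1 * s2 * s1])] in
  (forall c, List.In c cases -> c.1 -> alternation_set lambda mu = c.2) /\
  (~~ has fst cases -> alternation_set lambda mu = set0).
Proof.
move=> lambda mu C1 C2 N M L1 L2 L3 L4 L5 L6 L7 L8.
have [a ac1] := dvdzP hc1; have [b bn] := dvdnP hn.
have Ca : C1 = a%:~R * 2 by rewrite /C1 ac1 intrM.
have Nb : N = (b%:Z)%:~R * 2 by rewrite /N bn natrM.
have Mm : M = m%:Z%:~R by [].
have rat_ge0 (x : rat) (z : int) : x = z%:~R -> (0 <= x) = (0 <= z).
  by move->; rewrite ler0z.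
have L1E : L1 = (0 <= a * 2 + c2 - b%:Z * 2 - m%:Z).
  by apply: rat_ge0; rewrite ?Ca ?Nb /C2 Mm !(intrD, intrM, rmorphN) /=; field.
have L2E : L2 = (0 <= a - b%:Z + c2 - m%:Z).
  by apply: rat_ge0; rewrite ?Ca ?Nb /C2 Mm !(intrD, intrM, rmorphN) /=; field.
have L3E : L3 = (0 <= c2 - b%:Z * 2 - m%:Z - 1).
  by apply: rat_ge0; rewrite ?Ca ?Nb /C2 Mm !(intrD, intrM, rmorphN) /=; field.
have L4E : L4 = (0 <= a - b%:Z - m%:Z - 1).
  by apply: rat_ge0; rewrite ?Ca ?Nb /C2 Mm !(intrD, intrM, rmorphN) /=; field.
have L5E : L5 = (0 <= - a - b%:Z - m%:Z - 2).
  by apply: rat_ge0; rewrite ?Ca ?Nb /C2 Mm !(intrD, intrM, rmorphN) /=; field.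
have L6E : L6 = (0 <= - c2 - b%:Z * 2 - m%:Z - 3).
  by apply: rat_ge0; rewrite ?Ca ?Nb /C2 Mm !(intrD, intrM, rmorphN) /=; field.
have L7E : L7 = (0 <= - (a * 2) - c2 - b%:Z * 2 - m%:Z - 4).
  by apply: rat_ge0; rewrite ?Ca ?Nb /C2 Mm !(intrD, intrM, rmorphN) /=; field.
have L8E : L8 = (0 <= - a - b%:Z - c2 - m%:Z - 3).
  by apply: rat_ge0; rewrite ?Ca ?Nb /C2 Mm !(intrD, intrM, rmorphN) /=; field.
have arc : [:: L1; L2; L3; L5; L7; L8; L6; L4] \in
    [seq rot k (nseq j true ++ nseq (8 - j) false) | k <- iota 0 8, j <- iota 0 5].
  by rewrite L1E L2E L3E L4E L5E L6E L7E L8E; exact: inequalities_arc.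
have muE : mu = varpi1 *~ (b%:Z * 2) + varpi2 *~ m%:Z by rewrite /mu bn -PoszM -!pmulrn.
have -> : alternation_set lambda mu = [set` mask
    [:: L1 && L2; L3 && L2; L1 && L4; L3 && L5;
        L6 && L4; L7 && L5; L6 && L8; L7 && L8] weyl_elements].
  by rewrite muE /lambda ac1 alternation_setE -!(L1E, L2E, L3E, L4E, L5E, L6E, L7E, L8E).
(* From here the inequalities are arbitrary booleans subject only to [arc]. *)
clear -arc.
move: L1 L2 L3 L4 L5 L6 L7 L8 arc.
(* Each of the 24 guards asserts the two ends of an arc and denies its outer neighbours, so it
   singles out one arc of length 2, 3 or 4. Shorter arcs contain no neighbouring pair and give the
   empty set. *)
do 8![case] => //= _; split=> //; rewrite ?set_nil // => c;
  do 24![case=> [<-|]; first by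
    move=> //= _; apply/seteqP; split=> w /=; rewrite !inE;
    do ?[case: eqP => ? //=]; tauto];
  by case.
Qed.
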